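(* Let $k\ge2$ be an integer and $c\in(0,1)$. Let $(M_n)_{n\ge1}$ be integers with $1\le M_n\le kn-1$ and $M_n/(kn)\to c$ as $n\to\infty$. Then \[ \lim_{n\to\infty} P_{n,k}(\mathcal{S}^+(n,k;M_n))=-\big(1-(1-c)^k\big)\log\big(1-(1-c)^k\big). \]
   Context: Fix integers $k\ge2$, $n\ge1$. There are $kn$ items, $k$ items at each of the ranks $1,2,\dots,n$ (rank $n$ is highest). The items are revealed one at a time in a uniformly random order, i.e. the sequence of ranks is a uniformly random permutation of the multiset $\{1^k,2^k,\dots,n^k\}$; $P_{n,k}$ denotes this uniform probability. For $M\in\{1,\dots,kn-1\}$, the strategy $\mathcal{S}^+(n,k;M)$ lets the first $M$ items pass and then selects the first later-arriving item whose rank is strictly greater than the highest rank among the first $M$ items (if such an item exists; otherwise nothing is selected). $P_{n,k}(\mathcal{S}^+(n,k;M))$ denotes the probability that this strategy selects an item of rank $n$. *)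

(* Defs.v *)
From HB Require Import structures.
From mathcomp Require Import all_boot all_order all_algebra.
From mathcomp Require Import all_classical all_reals all_analysis.
Set Implicit Arguments. Unset Strict Implicit. Unset Printing Implicit Defensive.
Import Order.TTheory GRing.Theory Num.Theory.

(* An arrangement of the k*n items: position i (0-based) carries rank (f i).+1,
   so ranks range over 1..n (rank n highest). *)
Definition ranks_of (n k : nat) (f : {ffun 'I_(k * n) -> 'I_n}) : seq nat :=
  [seq (f i).+1 | i <- enum 'I_(k * n)].

Definition valid_arr (n k : nat) (f : {ffun 'I_(k * n) -> 'I_n}) : bool :=
  [forall r : 'I_n, #|[set i | f i == r]| == k].

Definition splus_success (n M : nat) (s : seq nat) : bool :=
  let thr := \max_(x <- take M s) x in
  let rest := drop M s in
  let j := find (fun x => thr < x) rest in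
  (j < size rest) && (nth 0 rest j == n).

Definition Psplus (R : realType) (n k M : nat) : R :=
  (#|[set f : {ffun 'I_(k * n) -> 'I_n} | valid_arr f && splus_success n M (ranks_of f)]|%:R
   / #|[set f : {ffun 'I_(k * n) -> 'I_n} | valid_arr f]|%:R)%R.

(* Main.v *)
Require Import Defs.
From HB Require Import structures.
From mathcomp Require Import all_boot all_order all_algebra all_fingroup.
From mathcomp Require Import all_classical all_reals all_analysis.
From mathcomp Require Import zify ring lra.
Set Implicit Arguments. Unset Strict Implicit. Unset Printing Implicit Defensive.
Import Order.TTheory GRing.Theory Num.Theory.
Import numFieldNormedType.Exports.

(* Let N = k n and q_j be the probability that the first M items all have rank
   at most n - j. Given that the highest of these ranks is n - j with j >= 1, each
   of the top j ranks is equally likely to be the first to appear afterwards, so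
   the success probability is the sum over j >= 1 of (q_j - q_(j+1)) / j.
   The k j items of the top j ranks occupy a uniformly random set of positions,
   so q_j = C(N - M, k j) / C(N, k j), which tends to (1 - c)^(k j). As q is
   nonincreasing and at most 1, the terms from j = J + 1 on telescope to at most
   1 / (J + 1), uniformly in n. Hence the limit may be taken termwise; with
   a = (1 - c)^k it is the sum of (1 - a) a^j / j, that is -(1 - a) ln (1 - a). *)

(** * The stopping rule, and a fact on finite sets *)

Definition threshold (n k M : nat) (f : {ffun 'I_(k * n) -> 'I_n}) : nat :=
  \max_(x <- take M (ranks_of f)) x.

(** The bound [t] is a separate argument, so that it stays fixed while [f] is relabelled. A failed
    search yields the default 0, which is no rank. *)
Definition first_above (n k M t : nat) (f : {ffun 'I_(k * n) -> 'I_n}) : nat :=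
  nth 0 (drop M (ranks_of f)) (find (ltn t) (drop M (ranks_of f))).

(** List [A] and then its complement, do the same for [B], and match entries of equal index. Since
    the first blocks have the same length, [A] lands on [B]. *)
Lemma exists_perm_imset (T : finType) (A B : {set T}) :
  #|A| = #|B| -> exists s : {perm T}, s @: A = B.
Proof.
move=> eqAB.
pose sA := enum A ++ enum (~: A); pose sB := enum B ++ enum (~: B).
have memE (C : {set T}) x : x \in enum C ++ enum (~: C).
  by rewrite mem_cat !mem_enum inE orbN.
have uniqE (C : {set T}) : uniq (enum C ++ enum (~: C)).
  rewrite cat_uniq !enum_uniq andbT /=; apply/hasPn => x.
  by rewrite /= !mem_enum inE.
have szE (C : {set T}) : size (enum C ++ enum (~: C)) = #|T|.
  by rewrite size_cat -!cardE cardsC.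
pose g x := nth x sB (index x sA).
have inj_g : injective g.
  move=> x y; rewrite /g (set_nth_default y); last first.
    by rewrite szE -(szE A) index_mem memE.
  move/eqP; rewrite nth_uniq ?uniqE // ?szE -?(szE A) ?index_mem ?memE //.
  by move/eqP/(congr1 (nth x sA)); rewrite !nth_index ?memE.
exists (perm inj_g); apply/eqP; rewrite eqEcard card_imset ?eqAB ?leqnn ?andbT;
  last exact: perm_inj.
apply/fintype.subsetP => _ /imsetP[x xA ->]; rewrite permE /g.
have ix : index x sA < size (enum B).
  by rewrite /sA index_cat mem_enum xA -cardE -eqAB cardE index_mem mem_enum.
by rewrite /sB nth_cat ix -mem_enum mem_nth.
Qed.

Lemma card_ord_geq m a : #|[set i : 'I_m | a <= i]| = m - a.
Proof.
rewrite -sum1dep_card -(big_mkord (fun i => a <= i) (fun=> 1)).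
have [am|ma] := leqP a m; last first.
  by rewrite big1_seq => [|i]; rewrite ?mem_index_iota; lia.
rewrite (big_cat_nat (n := a)) //= big1_seq ?add0n; last first.
  by move=> i; rewrite mem_index_iota; lia.
rewrite big_nat_cond (eq_bigl (fun i => (a <= i < m) && true)) -?big_nat_cond.
  by rewrite sum_nat_const_nat muln1.
by move=> i; lia.
Qed.

(** * Counting arrangements by their threshold *)

Section Arrangements.
Variables n k M : nat.
Implicit Types (f : {ffun 'I_(k * n) -> 'I_n}) (t : nat).

Lemma valid_arrP f :
  reflect (forall r, #|[set i | f i == r]| = k) (valid_arr f).
Proof. by apply: (iffP forallP) => h r; apply/eqP/h. Qed.

Lemma take_ranks f :
  take M (ranks_of f) = [seq (f i).+1 | i <- take M (enum 'I_(k * n))].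
Proof. by rewrite map_take. Qed.

Lemma drop_ranks f :
  drop M (ranks_of f) = [seq (f i).+1 | i <- drop M (enum 'I_(k * n))].
Proof. by rewrite map_drop. Qed.

(** Values of [f] are 0-based and ranks 1-based, so a rank at most [t] reads [f i < t], and the
    ranks above [t] are the [r : 'I_n] with [t <= r]. *)
Lemma threshold_leP f t :
  reflect (forall i : 'I_(k * n), i < M -> f i < t) (threshold M f <= t).
Proof.
rewrite /threshold take_ranks.
apply: (iffP (bigmax_leqP_seq _ _ _ _)) => h.
  move=> i iM; apply: h => //; apply: map_f.
  by rewrite in_take ?mem_enum // index_enum_ord.
move=> _ /mapP[i iM ->] _; apply: h.
by move: iM; rewrite in_take ?mem_enum // index_enum_ord.
Qed.

Lemma threshold_le_n f : threshold M f <= n.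
Proof. by apply/threshold_leP => i _; apply: ltn_ord. Qed.

Lemma threshold_gt0 f : 0 < M -> 0 < k * n -> 0 < threshold M f.
Proof.
move=> M0 kn0; rewrite lt0n -leqn0; apply/negP => /threshold_leP.
by move/(_ (Ordinal kn0) M0).
Qed.

Lemma splus_successE f :
  0 < n -> splus_success n M (ranks_of f) = (first_above M (threshold M f) f == n).
Proof.
move=> n0; rewrite /splus_success -/(threshold M f) /first_above.
rewrite (eq_find (a2 := ltn (threshold M f))) //.
case: ltnP => //= h; rewrite nth_default //.
by symmetry; apply/negbTE; rewrite eq_sym -lt0n.
Qed.

(** The search succeeds: as [k > 0] some item has rank [n], and as the threshold is below [n] this
    item is not among the first [M]. *)
Lemma first_above_bounds f t :
  valid_arr f -> 0 < k -> threshold M f = t -> t < n ->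
  t < first_above M t f <= n.
Proof.
move=> vf k0 thr tn.
have ltn1 : n.-1 < n by rewrite prednK // (leq_ltn_trans _ tn).
have /card_gt0P[i] : 0 < #|[set i | f i == Ordinal ltn1]|.
  by rewrite (valid_arrP _ vf).
rewrite inE => /eqP fi.
have iM : M <= i.
  rewrite leqNgt; apply/negP => iM.
  have /threshold_leP/(_ _ iM) : threshold M f <= t by rewrite thr.
  by rewrite fi /= ltnNge -ltnS prednK ?tn // (leq_ltn_trans _ tn).
have hasD : has (ltn t) (drop M (ranks_of f)).
  rewrite drop_ranks; apply/hasP; exists (f i).+1.
    apply: map_f; have: i \in enum 'I_(k * n) by rewrite mem_enum.
    rewrite -[X in i \in X](cat_take_drop M) mem_cat in_take ?mem_enum //.
    by rewrite index_enum_ord ltnNge iM.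
  by rewrite /= fi /= prednK // (leq_ltn_trans _ tn).
apply/andP; split; first exact: nth_find hasD.
have : first_above M t f \in ranks_of f.
  by apply: (mem_drop (n0 := M)); apply: mem_nth; rewrite -has_find.
by case/mapP => j _ ->; apply: ltn_ord.
Qed.

(** * Symmetry under permutations of the ranks *)

Definition relabel (s : {perm 'I_n}) f : {ffun 'I_(k * n) -> 'I_n} :=
  [ffun i => s (f i)].

Lemma relabelK (s : {perm 'I_n}) : cancel (relabel s) (relabel s^-1%g).
Proof. by move=> f; apply/ffunP => i; rewrite !ffunE permK. Qed.

Lemma valid_relabel (s : {perm 'I_n}) f : valid_arr f -> valid_arr (relabel s f).
Proof.
move=> /valid_arrP vf; apply/valid_arrP => r; rewrite -[RHS](vf (s^-1%g r)).
by apply: eq_card => i; rewrite !inE ffunE -[in RHS](inj_eq (@perm_inj _ s)) permKV.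
Qed.

Lemma threshold_relabel (s : {perm 'I_n}) f t :
  (forall r : 'I_n, r < t -> s r = r) -> threshold M f = t ->
  threshold M (relabel s f) = t.
Proof.
move=> sfix thr; rewrite -[RHS]thr /threshold.
suff -> : take M (ranks_of (relabel s f)) = take M (ranks_of f) by [].
rewrite !take_ranks; apply/eq_in_map => i; rewrite in_take ?mem_enum // index_enum_ord => iM.
rewrite ffunE sfix //.
have /threshold_leP/(_ i) : threshold M f <= t by rewrite thr.
exact.
Qed.

(** A permutation fixing all ranks up to [t] also preserves the set of ranks above [t], so the
    search stops at the same position. *)
Lemma first_above_relabel (s : {perm 'I_n}) f t (r : 'I_n) :
  (forall r : 'I_n, r < t -> s r = r) -> first_above M t f = r.+1 ->
  first_above M t (relabel s f) = (s r).+1.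
Proof.
move=> sfix; rewrite /first_above !drop_ranks !find_map.
set D := drop _ _.
(* If [s x < t], then [s] fixes [s x], and injectivity gives [s x = x]. *)
have lts (x : 'I_n) : (s x < t) = (x < t).
  apply/idP/idP => xt; last by rewrite sfix.
  by rewrite -[x](perm_inj (sfix _ xt)).
rewrite (eq_find (a2 := preim (fun i => (f i).+1) (ltn t))); last first.
  by move=> i /=; rewrite ffunE !ltnS [LHS]leqNgt lts -leqNgt.
set j := find _ _.
case: (ltnP j (size D)) => jD; last by rewrite nth_default ?size_map.
have [i0 _] : exists i0 : 'I_(k * n), true.
  by case: (D) jD => // i0; exists i0.
by rewrite !(nth_map i0) // => -[]/val_inj <-; rewrite ffunE.
Qed.

Definition level_set t : {set {ffun 'I_(k * n) -> 'I_n}} :=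
  [set f | valid_arr f && (threshold M f == t)].

(** The transposition of [r] and [r'] injects the first set into the second. Exchanging the two
    ranks gives equality. *)
Lemma leq_card_first_above t (r r' : 'I_n) : t <= r -> t <= r' ->
  #|[set f in level_set t | first_above M t f == r.+1]| <=
  #|[set f in level_set t | first_above M t f == r'.+1]|.
Proof.
move=> tr tr'; pose s := tperm r r'.
have sfix (x : 'I_n) : x < t -> s x = x.
  move=> xt; rewrite /s tpermD //; apply: contraTN xt => /eqP <-;
  by rewrite -leqNgt.
rewrite -(card_imset _ (can_inj (relabelK s))); apply: subset_leq_card.
apply/fintype.subsetP => _ /imsetP[f + ->]; rewrite !inE.
case/andP => /andP[vf /eqP thr] /eqP fa.
rewrite valid_relabel //= (threshold_relabel sfix thr) eqxx /=.
by rewrite (first_above_relabel sfix fa) /s tpermL.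
Qed.

(* Permuting the ranks above the threshold shows that each of them is equally
   likely to be the first to appear. *)
Lemma card_level_set t : 0 < k -> t < n ->
  #|level_set t| =
  (n - t) * #|[set f in level_set t | first_above M t f == n]|.
Proof.
move=> k0 tn.
have n0 : 0 < n by exact: leq_ltn_trans tn.
have ltn1 : n.-1 < n by rewrite prednK.
pose top := Ordinal ltn1.
(* The 0-based rank of the selected item. By [first_above_bounds] the default [top] never occurs on
   the level set, which splits into [n - t] classes of equal size. *)
pose p f : 'I_n := insubd top (first_above M t f).-1.
rewrite -sum1_card (partition_big p (fun r : 'I_n => t <= r)) /=; last first.
  move=> f; rewrite inE => /andP[vf /eqP thr].
  have /andP[lo hi] := first_above_bounds vf k0 thr tn.
  by rewrite /p val_insubd; case: ifP => _ /=; lia.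
transitivity (\sum_(r < n | t <= r)
    #|[set f in level_set t | first_above M t f == n]|).
  apply: eq_bigr => r tr; rewrite sum1dep_card.
  transitivity #|[set f in level_set t | first_above M t f == r.+1]|.
    apply: eq_card => f; rewrite !inE; case: (boolP (valid_arr f && _)) => //.
    case/andP => vf /eqP thr /=.
    have /andP[lo hi] := first_above_bounds vf k0 thr tn.
    rewrite -val_eqE /p val_insubd.
    have -> : (first_above M t f).-1 < n by lia.
    by apply/eqP/eqP => /=; lia.
  have -> : [set f in level_set t | first_above M t f == n] =
     [set f in level_set t | first_above M t f == top.+1].
    by apply/setP => f; rewrite !inE /= prednK.
  apply/eqP; rewrite eqn_leq !leq_card_first_above //=; lia.
rewrite sum_nat_cond_const; congr (_ * _).
exact: card_ord_geq.
Qed.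

(** * Symmetry under permutations of the positions, and the resulting counts *)

Definition below t : {set {ffun 'I_(k * n) -> 'I_n}} :=
  [set f | valid_arr f && (threshold M f <= t)].

Lemma card_upper f t : valid_arr f -> t <= n ->
  #|[set i | t <= f i]| = k * (n - t).
Proof.
move=> /valid_arrP vf tn.
rewrite -sum1dep_card (partition_big f (fun r : 'I_n => t <= r)) //=.
transitivity (\sum_(r < n | t <= r) k).
  apply: eq_bigr => r tr; rewrite sum1dep_card -[RHS](vf r).
  by apply: eq_card => i; rewrite !inE; case: eqP => [->|]; rewrite ?tr ?andbF.
rewrite sum_nat_cond_const mulnC; congr (_ * _).
exact: card_ord_geq.
Qed.

(** Moving the items by a permutation of positions that carries [A] to [B] keeps every multiplicity,
    and it is injective on arrangements. *)
Lemma leq_card_upper_eq t (A B : {set 'I_(k * n)}) : #|A| = #|B| ->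
  #|[set f : {ffun 'I_(k * n) -> 'I_n} | valid_arr f & [set i | t <= f i] == A]| <=
  #|[set f : {ffun 'I_(k * n) -> 'I_n} | valid_arr f & [set i | t <= f i] == B]|.
Proof.
move=> /exists_perm_imset[s sAB].
pose g f : {ffun 'I_(k * n) -> 'I_n} := [ffun i => f (s^-1%g i)].
have gK : cancel g (fun f => [ffun i => f (s i)]).
  by move=> f; apply/ffunP => i; rewrite !ffunE permK.
rewrite -(card_imset _ (can_inj gK)); apply: subset_leq_card.
apply/fintype.subsetP => _ /imsetP[f + ->]; rewrite !inE.
case/andP => /valid_arrP vf /eqP fA; apply/andP; split.
  apply/valid_arrP => r; rewrite -[RHS](vf r) -(card_imset [set i | f i == r] (@perm_inj _ s)).
  apply: eq_card => i; rewrite inE ffunE -{2}(permKV s i) mem_imset ?inE //.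
  exact: perm_inj.
apply/eqP/setP => i; rewrite inE ffunE -sAB -fA -{2}(permKV s i).
by rewrite mem_imset ?inE //; exact: perm_inj.
Qed.

(* The set of positions of the items of rank above t is equidistributed among
   the sets of its size. *)
Lemma card_below t : t <= n -> M <= k * n ->
  #|below t| * 'C(k * n, k * (n - t)) =
  #|[set f : {ffun 'I_(k * n) -> 'I_n} | valid_arr f]| *
  'C(k * n - M, k * (n - t)).
Proof.
move=> tn MN; set d := k * (n - t).
pose up f := [set i | t <= f i].
pose w (A : {set 'I_(k * n)}) :=
  #|[set f : {ffun 'I_(k * n) -> 'I_n} | valid_arr f & up f == A]|.
have wE (A B : {set 'I_(k * n)}) : #|A| = #|B| -> w A = w B.
  by move=> eqAB; apply/eqP; rewrite eqn_leq !leq_card_upper_eq.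
pose late := [set i : 'I_(k * n) | M <= i].
(* Sort the arrangements by their set of upper positions, which always has size [d]. *)
have cE (Q : pred {set 'I_(k * n)}) :
  #|[set f | valid_arr f & Q (up f)]| =
  \sum_(A : {set 'I_(k * n)} | (#|A| == d) && Q A) w A.
  rewrite -sum1dep_card (partition_big up (fun A => (#|A| == d) && Q A)) /=.
    apply: eq_bigr => A /andP[_ QA]; rewrite sum1dep_card; apply: eq_card => f.
    by rewrite !inE; case: eqP => [->|]; rewrite ?QA ?andbT ?andbF.
  by move=> f /andP[vf Qf]; rewrite Qf andbT card_upper.
(* The threshold is at most [t] exactly when every item of larger rank arrives after the first
   [M]. *)
have -> : below t = [set f | valid_arr f & up f \subset late].
  apply/setP => f; rewrite !inE; congr (_ && _).
  apply/threshold_leP/fintype.subsetP => h i.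
    rewrite !inE => ti; rewrite leqNgt; apply/negP => /h; by rewrite ltnNge ti.
  by move=> iM; rewrite ltnNge; apply/negP => ti; have := h i; rewrite !inE ti leqNgt iM => /(_ isT).
have -> : [set f : {ffun 'I_(k * n) -> 'I_n} | valid_arr f] =
   [set f | valid_arr f & predT (up f)].
  by apply/setP => f; rewrite !inE andbT.
rewrite (cE (fun A => A \subset late)) (cE predT).
(* A reference set: all sets of size [d] have the weight [w A0], so each count is [w A0] times a
   number of sets, that is, a binomial coefficient. *)
have [A0 A0d] : exists A0 : {set 'I_(k * n)}, #|A0| = d.
  have : 0 < #|[set A : {set 'I_(k * n)} | #|A| == d]|.
    by rewrite card_draws card_ord bin_gt0 leq_mul2l leq_subr orbT.
  by case/card_gt0P => A0; rewrite inE => /eqP; exists A0.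
have sE (Q : pred {set 'I_(k * n)}) :
  \sum_(A : {set 'I_(k * n)} | (#|A| == d) && Q A) w A =
  #|[set A | Q A & #|A| == d]| * w A0.
  rewrite -sum_nat_cond_const; apply: eq_big => A; first by rewrite andbC.
  by case/andP => /eqP Ad _; apply: wE; rewrite Ad A0d.
rewrite !sE cards_draws.
have -> : #|late| = k * n - M.
  exact: card_ord_geq.
have -> : #|[set A : {set 'I_(k * n)} | predT A & #|A| == d]| = 'C(k * n, d).
  by rewrite -[k * n in RHS]card_ord -card_draws; apply: eq_card => A; rewrite !inE.
by rewrite mulnAC [RHS]mulnAC mulnC [RHS]mulnC; congr (_ * _); rewrite mulnC.
Qed.

(** Identify the positions with pairs in ['I_k * 'I_n] and take the second component as rank: each
    fibre is a copy of ['I_k]. *)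
Lemma card_valid_gt0 : 0 < #|[set f : {ffun 'I_(k * n) -> 'I_n} | valid_arr f]|.
Proof.
pose e (i : 'I_(k * n)) : 'I_k * 'I_n := enum_val (cast_ord (esym (mxvec_cast k n)) i).
have eK : cancel (fun p => mxvec_index p.1 p.2) e.
  by move=> [a b]; rewrite /e cast_ordK enum_rankK.
have Ke : cancel e (fun p => mxvec_index p.1 p.2).
  by move=> i; case/mxvec_indexP: i => a b; rewrite (eK (a, b)).
apply/card_gt0P; exists [ffun i => (e i).2]; rewrite inE; apply/valid_arrP => r.
rewrite -[RHS]card_ord -[RHS](card_imset predT (f := fun a : 'I_k => mxvec_index a r)).
  apply: eq_card => i; rewrite inE ffunE; apply/eqP/imsetP => [<-|[a _ ->]].
    by exists (e i).1 => //; rewrite Ke.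
  by rewrite (eK (a, r)).
by move=> a b /(congr1 e); rewrite (eK (a, r)) (eK (b, r)) => -[].
Qed.

(** At [t = 0] the predecessor is again 0. The identity survives because [M > 0] forces a positive
    threshold, so that [level_set 0] is empty. *)
Lemma card_below_pred t : 0 < M -> 0 < k * n ->
  #|below t| = #|level_set t| + #|below t.-1|.
Proof.
move=> M0 kn0; case: t => [|t].
  rewrite [X in _ = X + _](_ : _ = 0) //; apply: eq_card0 => f; rewrite !inE.
  by rewrite gtn_eqF ?andbF // threshold_gt0.
have -> : below t.+1 = level_set t.+1 :|: below t.
  by apply/setP => f; rewrite !inE leq_eqVlt ltnS -andb_orr.
rewrite cardsU disjoint_setI0 ?cards0 ?subn0 // disjoint_subset.
apply/fintype.subsetP => f; rewrite !inE => /andP[-> /eqP ->] /=.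
by rewrite ltnn.
Qed.

Lemma card_success : 0 < k -> 0 < n ->
  #|[set f : {ffun 'I_(k * n) -> 'I_n} | valid_arr f && splus_success n M (ranks_of f)]| =
  \sum_(t < n) #|[set f in level_set t | first_above M t f == n]|.
Proof.
move=> k0 n0.
rewrite -sum1dep_card.
rewrite (partition_big (fun f => inord (threshold M f) : 'I_n.+1) predT) //=.
(* Threshold [n] contributes nothing: a successful search would give a rank above [n], and a failed
   one gives 0, which is not [n]. *)
rewrite big_ord_recr /= [X in _ + X]big1 ?addn0; last first.
  move=> f /andP[/andP[vf]]; rewrite splus_successE // => /eqP fa /eqP thr.
  have thrn : threshold M f = n.
    by rewrite -[RHS]/(val (@ord_max n)) -thr /= inordK // ltnS threshold_le_n.
  have := fa; rewrite thrn /first_above => fa'.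
  have : n < n; last by rewrite ltnn.
  rewrite -{2}fa'; apply: nth_find; rewrite has_find ltnNge; apply/negP => h.
  by rewrite nth_default // in fa'; rewrite -fa' in n0.
apply: eq_bigr => t _; rewrite sum1dep_card; apply: eq_card => f; rewrite !inE.
rewrite splus_successE // -val_eqE /= inordK ?ltnS ?threshold_le_n //.
by rewrite andbAC; case: (threshold M f =P t) => [->|]; rewrite ?andbF.
Qed.

End Arrangements.

Local Open Scope ring_scope.
Local Open Scope classical_set_scope.

(** * The logarithmic series, a tail bound and limits of falling factorials *)

Section RealAnalysis.
Variable R : realType.
Implicit Types (a x : R) (u : nat -> R).

(** As a function of [a], the expression inside the norm vanishes at 0 and has derivative
    [- x ^+ m / (1 - x)]; the mean value theorem on [0, a] gives the bound. *)
Lemma ln1B_series_bound a m : 0 < a < 1 ->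
  `|ln (1 - a) + \sum_(j < m) a ^+ j.+1 / j.+1%:R| <= a ^+ m / (1 - a).
Proof.
move=> /andP[a0 a1].
pose f x : R := ln (1 - x) + \sum_(j < m) j.+1%:R^-1 * x ^+ j.+1.
pose df x : R := - (x ^+ m / (1 - x)).
have fE x : f x = ln (1 - x) + \sum_(j < m) x ^+ j.+1 / j.+1%:R.
  by congr (_ + _); apply: eq_bigr => j _; rewrite mulrC.
have f'E x : x < 1 -> is_derive x 1 f (df x).
  move=> x1.
  have lnx : is_derive (1 - x) 1 (@ln R) (1 - x)^-1.
    by apply: is_derive1_ln; rewrite subr_gt0.
  have -> : f = (@ln R \o (fun y => cst 1 y - y)) +
     \sum_(j < m) (j.+1%:R^-1 *: (@id R) ^+ j.+1).
    apply/funext => y; rewrite /f /= fctE fct_sumE; congr (_ + _).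
    apply: eq_bigr => j _.
    by rewrite [RHS]/GRing.scale /= exprfctE.
  apply: is_derive_eq.
  rewrite /df; under eq_bigr => j _.
    rewrite /GRing.scale /= mulr1 mulKf ?pnatr_eq0 //; over.
  have x1' : 1 - x != 0 by rewrite subr_eq0 eq_sym lt_eqF.
  (* Multiplying by [1 - x] collapses the geometric sum: -1 + (1 - x^m) = -x^m. *)
  apply: (mulIf x1').
  rewrite mulrDl [X in _ + X = _](_ : _ = 1 - x ^+ m).
    by field.
  by rewrite -(opprB x) mulrN mulrC -subrX1 opprB.
have [x xin] : exists2 x, x \in `[0, a]%R & f a - f 0 = df x * (a - 0).
  apply: MVT_segment; first exact: ltW.
    by move=> x; rewrite in_itv /= => /andP[_ xa]; apply: f'E; apply: lt_trans a1.
  apply: derivable_within_continuous => x; rewrite in_itv /= => /andP[_ xa].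
  have := f'E x (le_lt_trans xa a1) => h; exact: ex_derive.
have -> : f 0 = 0.
  rewrite /f subr0 ln1 add0r big1 // => j _; by rewrite expr0n mulr0.
move: xin; rewrite in_itv /= => /andP[x0 xa].
rewrite !subr0 -fE => ->; rewrite /df.
have x1 : 0 < 1 - x by rewrite subr_gt0 (le_lt_trans xa).
have q0 : 0 <= x ^+ m / (1 - x) by rewrite divr_ge0 ?exprn_ge0 // ltW.
rewrite normrM normrN (ger0_norm q0) (gtr0_norm a0).
rewrite -[leRHS]mulr1; apply: ler_pM => //; [exact: ltW| |exact: ltW].
apply: ler_pM; rewrite ?exprn_ge0 ?invr_ge0 //.
- exact: ltW.
- by apply: lerXn2r => //; rewrite nnegrE // ltW.
- by rewrite lef_pV2 ?posrE ?subr_gt0 ?(le_lt_trans xa) // lerB.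
Qed.

Lemma cvg_ln1B_series a : 0 < a < 1 ->
  (fun m => \sum_(j < m) a ^+ j.+1 / j.+1%:R) @ \oo --> - ln (1 - a).
Proof.
move=> a01; apply/cvgrPdist_le => e e0.
have /cvgrPdist_le /(_ e e0) : (fun m => a ^+ m / (1 - a)) @ \oo --> (0 : R).
  rewrite -(mul0r (1 - a)^-1); apply: cvgMr_tmp; apply: cvg_expr.
  by case/andP: a01 => ? ?; rewrite ger0_norm ?ltW.
apply: filterS => m; rewrite sub0r normrN => h.
rewrite -opprD normrN; apply: le_trans (ln1B_series_bound m a01) _.
exact: le_trans (ler_norm _) h.
Qed.

(** Beyond [m] each weight is at most 1/(m+1), and the differences telescope to [u m - u p], which
    is at most 1. The bound is independent of [u] and [p]. *)
Lemma weighted_telescope_bounds u m p :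
  (forall j, u j.+1 <= u j) -> (forall j, 0 <= u j <= 1) -> (m <= p)%N ->
  \sum_(j < m) (u j - u j.+1) / j.+1%:R <= \sum_(j < p) (u j - u j.+1) / j.+1%:R
    <= \sum_(j < m) (u j - u j.+1) / j.+1%:R + m.+1%:R^-1.
Proof.
move=> udec u01 mp.
rewrite -!(big_mkord xpredT (fun j => (u j - u j.+1) / j.+1%:R)).
rewrite (big_cat_nat (n := m) (p := p)) //= lerDl lerD2l; apply/andP; split.
  by apply: sumr_ge0 => j _; rewrite divr_ge0 // subr_ge0.
apply: (@le_trans _ _ (\sum_(m <= j < p) (u j - u j.+1) / m.+1%:R)).
  apply: ler_sum_nat => j /andP[mj _]; apply: ler_wpM2l; first by rewrite subr_ge0.
  by rewrite lef_pV2 ?posrE ?ltr0n // ler_nat.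
rewrite -mulr_suml -[leRHS]mul1r ler_wpM2r ?invr_ge0 //.
have -> : \sum_(m <= j < p) (u j - u j.+1) = u m - u p.
  rewrite -[RHS]opprB -telescope_sumr // -sumrN.
  by apply: eq_bigr => j _; rewrite opprB.
have := u01 m; have := u01 p; lra.
Qed.

(** Even when truncated, [x n - d] lies between the real difference and [x n], and d/N tends to
    0. *)
Lemma cvg_natB_ratio (x N : nat -> nat) (l : R) d :
  (fun n => (N n)%:R : R) @ \oo --> +oo ->
  (fun n => (x n)%:R / (N n)%:R) @ \oo --> l ->
  (fun n => (x n - d)%:R / (N n)%:R) @ \oo --> l.
Proof.
move=> Noo xl.
have dN : (fun n => d%:R / (N n)%:R : R) @ \oo --> (0 : R).
  rewrite -(mulr0 d%:R); apply: cvgMl_tmp; apply/gtr0_cvgV0 => //.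
  by move/cvgryPgt : Noo; apply.
apply: (@squeeze_cvgr _ _ _ _ (fun n => (x n)%:R / (N n)%:R - d%:R / (N n)%:R)
  (fun n => (x n)%:R / (N n)%:R)) => //; last first.
  by rewrite -[l]subr0; apply: cvgB.
apply: nearW => n; rewrite -mulrBl; apply/andP; split.
  apply: ler_wpM2r; rewrite ?invr_ge0 // lerBlDr -natrD ler_nat; lia.
by apply: ler_wpM2r; rewrite ?invr_ge0 // ler_nat leq_subr.
Qed.

(** A ratio of falling factorials is a product of [d] ratios [(x n - i) / (N n - i)], each tending
    to [l]. *)
Lemma cvg_ffact_ratio (x N : nat -> nat) (l : R) d :
  (fun n => (N n)%:R : R) @ \oo --> +oo ->
  (fun n => (x n)%:R / (N n)%:R) @ \oo --> l ->
  (fun n => (x n ^_ d)%:R / (N n ^_ d)%:R) @ \oo --> l ^+ d.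
Proof.
move=> Noo xl.
have N0 : \forall n \near \oo, (0 : R) < (N n)%:R by move/cvgryPgt : Noo; apply.
have NN : (fun n => (N n)%:R / (N n)%:R) @ \oo --> (1 : R).
  apply: cvg_near_cst; apply: filterS N0 => n h; by rewrite divff ?gt_eqF.
elim: d => [|d IH].
  by under eq_fun do rewrite !ffactn0 divr1; exact: cvg_cst.
rewrite exprSr.
have step : (fun n => (x n - d)%:R / (N n - d)%:R) @ \oo --> l.
  (* Divide both parts by [N n]; the new denominator tends to 1. *)
  have h : (fun n => ((x n - d)%:R / (N n)%:R) / ((N n - d)%:R / (N n)%:R)) @ \oo --> l / 1.
    apply: cvgM; first exact: cvg_natB_ratio.
    by apply: cvgV; rewrite ?oner_neq0 //; exact: cvg_natB_ratio.
  rewrite divr1 in h; apply: cvg_trans h; apply: near_eq_cvg.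
  apply: filterS N0 => n h; rewrite invf_div mulrA divfK // gt_eqF //.
apply: cvg_trans (cvgM IH step); apply: near_eq_cvg; apply: nearW => n.
by rewrite /= !ffactnSr !natrM -mulf_div.
Qed.

End RealAnalysis.

(** * The success probability as a weighted sum, and its terms in the limit *)

Section SuccessProbability.
Variable R : realType.

(** This is q_j. Truncated subtraction extends it constantly beyond [j = n], so that it is
    nonincreasing over all [j]. *)
Definition below_prob (n k M j : nat) : R :=
  #|below n k M (n - j)|%:R /
  #|[set f : {ffun 'I_(k * n) -> 'I_n} | valid_arr f]%SET|%:R.

Lemma below_prob_ge0_le1 n k M j : 0 <= below_prob n k M j <= 1.
Proof.
rewrite /below_prob divr_ge0 //= ler_pdivrMr ?ltr0n ?card_valid_gt0 // mul1r ler_nat.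
by apply: subset_leq_card; apply/fintype.subsetP => f; rewrite !inE => /andP[].
Qed.

Lemma below_prob_nonincreasing n k M j :
  below_prob n k M j.+1 <= below_prob n k M j.
Proof.
rewrite /below_prob ler_wpM2r ?invr_ge0 // ler_nat.
apply: subset_leq_card; apply/fintype.subsetP => f; rewrite !inE.
by case/andP => -> /= /leq_trans; apply; rewrite leq_sub2l.
Qed.

(** The index [j] stands for the threshold [n - j.+1], which has [j.+1] ranks above it; hence the
    reversal of the sum. *)
Lemma PsplusE n k M : (0 < k)%N -> (0 < n)%N -> (0 < M)%N ->
  Psplus R n k M =
  \sum_(j < n) (below_prob n k M j.+1 - below_prob n k M j.+2) / j.+1%:R.
Proof.
move=> k0 n0 M0; rewrite /Psplus card_success // natr_sum mulr_suml.
rewrite (reindex_inj rev_ord_inj) /=; apply: eq_bigr => j _.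
have jn := ltn_ord j.
rewrite /below_prob -mulrBl mulrAC; congr (_ / _).
have -> : (n - j.+2 = (n - j.+1).-1)%N by lia.
rewrite (@card_below_pred n k M (n - j.+1)) ?muln_gt0 ?k0 // natrD addrK.
rewrite card_level_set //; last lia.
have -> : (n - (n - j.+1) = j.+1)%N by lia.
by rewrite natrM mulrAC mulfV ?mul1r // pnatr_eq0.
Qed.

(** The factor (k j)! cancels from the quotient of binomials. What remains has [k * j] factors above
    and below, a number that does not grow with [n]. *)
Lemma below_probE n k M j : (j <= n)%N -> (M <= k * n)%N ->
  below_prob n k M j =
  ((k * n - M) ^_ (k * j))%:R / ((k * n) ^_ (k * j))%:R.
Proof.
move=> jn MN.
have V0 : #|[set f : {ffun 'I_(k * n) -> 'I_n} | valid_arr f]%SET|%:R != 0 :> R.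
  by rewrite pnatr_eq0 -lt0n card_valid_gt0.
have F0 : ((k * n) ^_ (k * j))%:R != 0 :> R.
  by rewrite pnatr_eq0 -lt0n ffact_gt0 leq_mul2l jn orbT.
apply/eqP; rewrite /below_prob eqr_div // -!natrM eqr_nat.
have := @card_below n k M (n - j) (leq_subr _ _) MN.
rewrite subKn // => h.
by rewrite -!bin_ffact mulnA h [eqbRHS]mulnC mulnA.
Qed.

Lemma cvg_below_prob k (c : R) (M : nat -> nat) j : (0 < k)%N ->
  (forall n, (1 <= n)%N -> (M n <= k * n)%N) ->
  (fun n => (M n)%:R / (k * n)%:R : R) @ \oo --> c ->
  (fun n => below_prob n k (M n) j) @ \oo --> ((1 - c) ^+ k) ^+ j.
Proof.
move=> k0 MN Mc; rewrite -exprM.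
have Noo : (fun n => (k * n)%:R : R) @ \oo --> +oo.
  apply/cvgryPge => A; near=> n; apply: (@le_trans _ _ n%:R).
    by near: n; exact: nbhs_infty_ger.
  by rewrite ler_nat leq_pmull.
have ratio : (fun n => (k * n - M n)%:R / (k * n)%:R : R) @ \oo --> 1 - c.
  have h : (fun n => 1 - (M n)%:R / (k * n)%:R : R) @ \oo --> 1 - c.
    by apply: cvgB => //; exact: cvg_cst.
  apply: cvg_trans h; apply: near_eq_cvg; near=> n.
  have n0 : (0 < n)%N by near: n; exists 1%N.
  rewrite natrB ?MN // mulrBl divff // pnatr_eq0 -lt0n muln_gt0 k0 //.
apply: cvg_trans (cvg_ffact_ratio (d := (k * j)%N) Noo ratio).
apply: near_eq_cvg; near=> n.
have n0 : (0 < n)%N by near: n; exists 1%N.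
by rewrite below_probE // ?MN //; near: n; exists j.
Unshelve. all: by end_near. Qed.

End SuccessProbability.

(** * Passage to the limit under the sum *)

Theorem theorem2 (R : realType) (k : nat) (c : R) (M : nat -> nat) :
  (2 <= k)%N -> 0 < c < 1 ->
  (forall n : nat, (1 <= n)%N -> (1 <= M n <= k * n - 1)%N) ->
  ((fun n : nat => ((M n)%:R / (k * n)%:R : R)) @ \oo --> c) ->
  ((fun n : nat => Psplus R n k (M n)) @ \oo -->
    - (1 - (1 - c) ^+ k) * ln (1 - (1 - c) ^+ k)).
Proof.
move=> k2 /andP[c0 c1] HM Mc; set a := (1 - c) ^+ k.
have k0 : (0 < k)%N by exact: leq_trans k2.
have a01 : 0 < a < 1.
  rewrite exprn_gt0 ?subr_gt0 //= exprn_ilt1 ?subr_ge0 ?(ltW c1) //.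
    by rewrite -lt0n.
  by rewrite ltrBlDr ltrDl.
pose S m := \sum_(j < m) (a ^+ j.+1 - a ^+ j.+2) / j.+1%:R.
have S_cvg : S @ \oo --> - (1 - a) * ln (1 - a).
  have h : (fun m => (1 - a) * \sum_(j < m) a ^+ j.+1 / j.+1%:R) @ \oo -->
      (1 - a) * - ln (1 - a) by apply: cvgMl_tmp; exact: cvg_ln1B_series.
  rewrite mulNr -mulrN; apply: cvg_trans h.
  apply: near_eq_cvg; apply: nearW => m; rewrite /S mulr_sumr.
  by apply: eq_bigr => j _; rewrite mulrA [a ^+ j.+2]exprS mulrBl mul1r.
(* The sum for [n] items per copy, cut after [m] terms; [T n n] is the success probability. *)
pose T m n := \sum_(j < m)
  (below_prob R n k (M n) j.+1 - below_prob R n k (M n) j.+2) / j.+1%:R.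
have T_cvg m : T m @ \oo --> S m.
  apply: cvg_big => [|j _]; first exact: add_continuous.
  apply: cvgMr_tmp; apply: cvgB; apply: cvg_below_prob => // n n1;
    by have := HM n n1; lia.
apply/cvgrPdist_le => e e0.
have e30 : 0 < e / 3 by rewrite divr_gt0.
(* Choose [m] first, to make both the tail of the limit series and the uniform tail bound 1/(m+1)
   small; only then let [n] grow, so that [T m n] is near [S m]. *)
have [m [Sm hm]] : exists m, `|- (1 - a) * ln (1 - a) - S m| <= e / 3
    /\ m.+1%:R^-1 <= e / 3.
  near \oo => m; exists m; split.
    by near: m; move/cvgrPdist_le : S_cvg; apply.
  have : `|0 - @harmonic R m| <= e / 3.
    by near: m; move/cvgrPdist_le : (@cvg_harmonic R); apply.
  by rewrite sub0r normrN /=; apply: le_trans; exact: ler_norm.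
near=> n.
have n0 : (0 < n)%N by near: n; exists 1%N.
have mn : (m <= n)%N by near: n; exists m.
have Tm : `|S m - T m n| <= e / 3.
  by near: n; move/cvgrPdist_le : (T_cvg m); apply.
rewrite PsplusE //; last by case/andP: (HM n n0).
have /andP[lo hi] : T m n <= T n n <= T m n + m.+1%:R^-1.
  (* The sequence is shifted by one, since the sum starts at q_1. *)
  apply: (@weighted_telescope_bounds R (fun j => below_prob R n k (M n) j.+1)) => //.
    by move=> j; exact: below_prob_nonincreasing.
  by move=> j; exact: below_prob_ge0_le1.
rewrite -/(T n n).
move: Sm Tm hm hi; rewrite !ler_norml => /andP[s1 s2] /andP[t1 t2].
move: (m.+1%:R^-1) (- (1 - a) * ln (1 - a)) s1 s2 => x L s1 s2 hm hi.
apply/andP; split; lra.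
Unshelve. all: by end_near. Qed.
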